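(* Let $N\ge 1$ and $p\ge N$ be integers, let $\sim$ be an equivalence relation on $\{1,\dots,N\}$, and let $\phi_1^*,\dots,\phi_N^*\in\mathbb{R}^p$ be vectors with $\|\phi_i^*\|=1$ for all $i$ and, for all $i,j$, $$\phi_i^{*T}\phi_j^*=\begin{cases}1 & \text{if } i\sim j,\\ 0&\text{otherwise.}\end{cases}$$ Let $\Phi^*=[\phi_1^*,\dots,\phi_N^*]\in\mathbb{R}^{p\times N}$ and $\Sigma^*=\Phi^{*T}\Phi^*\in\mathbb{R}^{N\times N}$, and let $\lambda_1^*\ge\cdots\ge\lambda_N^*\ge 0$ be the eigenvalues of $\Sigma^*$ (counted with multiplicity). Then: 1. $\sum_{i=1}^N\lambda_i^*=N$. 2. The number of indices $i$ with $\lambda_i^*\neq 0$ equals the number of equivalence classes of $\sim$. 3. Each nonzero $\lambda_i^*$ is equal to the cardinality of some equivalence class of $\sim$.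
   Context: The index $i\in\{1,\dots,N\}$ labels the $i$-th generated answer $y^{(i)}$ in a set of $N$ answers. The relation $i\sim j$ means that $y^{(i)}$ and $y^{(j)}$ share the same meaning; its equivalence classes are the (ideal) semantic clusters. The vectors $\phi_i^*=E^*(y^{(i)})$ are the normalized embeddings of the answers under an ideal sentence encoder $E^*$, and $\Sigma^*$ is their Gram matrix. All norms are Euclidean. *)

(* Defs.v *)
From HB Require Import structures.
From mathcomp Require Import all_boot all_order all_algebra.
From mathcomp Require Import reals.

Set Implicit Arguments.
Unset Strict Implicit.
Unset Printing Implicit Defensive.

Import Order.TTheory GRing.Theory Num.Theory.
Local Open Scope ring_scope.

(* The canonical norm of MathComp-Analysis on matrices is the sup norm, hence
   an explicit Euclidean norm. *)
Definition euclidean_norm (R : realType) (p : nat) (v : 'cV[R]_p) : R :=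
  Num.sqrt (\sum_(k < p) v k 0 ^+ 2).

Definition mx_of_cols (R : realType) (p N : nat) (phi : 'I_N -> 'cV[R]_p) :
    'M[R]_(p, N) :=
  \matrix_(k < p, j < N) phi j k 0.

Definition gram_mx (R : realType) (p N : nat) (phi : 'I_N -> 'cV[R]_p) :
    'M[R]_N :=
  (mx_of_cols phi)^T *m mx_of_cols phi.

(* [lam] lists the eigenvalues of [A] in nonincreasing order, each repeated
   according to its multiplicity as a root of the characteristic polynomial. *)
Definition ordered_eigenvalues (R : realType) (N : nat) (A : 'M[R]_N)
    (lam : 'I_N -> R) : Prop :=
  char_poly A = \prod_(i < N) ('X - (lam i)%:P) /\
  (forall i j : 'I_N, (i <= j)%N -> lam j <= lam i).

Definition eq_classes (N : nat) (sim : rel 'I_N) : {set {set 'I_N}} :=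
  equivalence_partition sim [set: 'I_N].

(* Main.v *)
(** Let [B] be the 0/1 incidence matrix of the answers against the classes of
    [sim]. The Gram matrix is [B *m B^T], whereas [B^T *m B] is the diagonal
    matrix of the class sizes. By Sylvester's identity these two products have
    the same characteristic polynomial up to a power of ['X], so the spectrum
    of the Gram matrix is the multiset of class sizes padded with zeros. *)

Require Import Defs.
From HB Require Import structures.
From mathcomp Require Import all_boot all_order all_algebra.
From mathcomp Require Import reals.

Set Implicit Arguments.
Unset Strict Implicit.
Unset Printing Implicit Defensive.

Import Order.TTheory GRing.Theory Num.Theory.
Local Open Scope ring_scope.

(** Schur complement argument: both sides come from the determinant of the single block matrix [M],
    made block triangular by two different left multiplications. *)
Lemma char_poly_mulmxC (R : comNzRingType) (m n : nat)
    (A : 'M[R]_(m, n)) (B : 'M[R]_(n, m)) :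
  'X^n * char_poly (A *m B) = 'X^m * char_poly (B *m A).
Proof.
rewrite /char_poly /char_poly_mx !map_mxM /=.
move: (map_mx _ A) (map_mx _ B) => {}A {}B.
pose M := block_mx 'X%:M A B 1%:M.
have detAB : \det ('X%:M - A *m B) = \det M.
  have := det_mulmx (block_mx 1%:M (- A) 0 1%:M) M.
  rewrite det_ublock !det1 !mul1r mulmx_block !mul1mx !mul0mx !add0r.
  by rewrite mulmx1 subrr mulNmx det_lblock det1 mulr1.
(* The block ['X%:M] clears [B] without dividing by ['X], since scalar matrices commute with [B];
   its determinant is the factor ['X^n]. *)
have := det_mulmx (block_mx 1%:M 0 (- B) 'X%:M) M.
rewrite det_lblock det1 mul1r det_scalar -detAB => <-.
rewrite mulmx_block !mul1mx !mul0mx !addr0 mulmx1 mul_scalar_mx mul_mx_scalar.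
by rewrite scalerN addNr det_ublock det_scalar mulNmx addrC.
Qed.

Section EquivalenceSpectrum.

Variables (R : realType) (N : nat) (sim : rel 'I_N).
Hypothesis hsim : equivalence_rel sim.

Local Notation P := (eq_classes sim).

Lemma eq_classes_partition : partition P [set: 'I_N].
Proof. by apply: equivalence_partitionP => x y z _ _ _; apply: hsim. Qed.

Lemma eq_classes_sim (i j : 'I_N) (C : {set 'I_N}) :
  C \in P -> i \in C -> (j \in C) = sim i j.
Proof.
move=> PC Ci; have [_ tiP _] := and3P eq_classes_partition.
by rewrite -(def_pblock tiP PC Ci) pblock_equivalence_partition ?inE.
Qed.

Lemma sum_card_eq_classes : (\sum_(C in P) #|C|)%N = N.
Proof. by rewrite -(card_partition eq_classes_partition) cardsT card_ord. Qed.

Lemma card_eq_classes_gt0 (C : {set 'I_N}) : C \in P -> (0 < #|C|)%N.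
Proof.
by move=> PC; rewrite lt0n cards_eq0 (partition_neq0 eq_classes_partition).
Qed.

Lemma card_eq_classes_le : (#|P| <= N)%N.
Proof.
rewrite -[leqRHS]sum_card_eq_classes -sum1_card.
by apply: leq_sum => C; apply: card_eq_classes_gt0.
Qed.

(** The truncated subtraction loses nothing: classes are nonempty and disjoint, so there are at most
    [N] of them and the list has exactly [N] entries. *)
Definition class_spectrum : seq R :=
  [seq #|C|%:R | C : {set 'I_N} <- enum P] ++ nseq (N - #|P|) 0.

Lemma size_class_spectrum : size class_spectrum = N.
Proof.
by rewrite size_cat size_map size_nseq -cardE subnKC ?card_eq_classes_le.
Qed.

Lemma class_spectrum_ge0 : all (>= 0) class_spectrum.
Proof.
by rewrite all_cat all_nseq lexx orbT andbT all_map; apply/allP => C _ /=.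
Qed.

Lemma sum_class_spectrum : \sum_(x <- class_spectrum) x = N%:R.
Proof.
rewrite big_cat big_nseq /= iter_addr_0 mul0rn addr0 big_map big_enum /=.
by rewrite -natr_sum sum_card_eq_classes.
Qed.

Lemma count_class_spectrum : count (predC1 0) class_spectrum = #|P|.
Proof.
rewrite count_cat count_nseq /= eqxx mul0n addn0 count_map cardE.
apply/eqP; rewrite -all_count; apply/allP => C; rewrite mem_enum => PC /=.
by rewrite pnatr_eq0 -lt0n card_eq_classes_gt0.
Qed.

Lemma class_spectrum_neq0 (x : R) : x \in class_spectrum -> x != 0 ->
  exists2 C : {set 'I_N}, C \in P & x = #|C|%:R.
Proof.
rewrite mem_cat => /orP[/mapP[C]|/nseqP[-> _]]; last by rewrite eqxx.
by rewrite mem_enum => PC -> _; exists C.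
Qed.

Lemma char_poly_equivalence_mx :
  char_poly (\matrix_(i < N, j < N) (sim i j)%:R) =
  \prod_(x <- class_spectrum) ('X - x%:P).
Proof.
pose cl (k : 'I_#|P|) : {set 'I_N} := enum_val k.
pose B : 'M[R]_(N, #|P|) := \matrix_(i, k) (i \in cl k)%:R.
have clP k : cl k \in P by apply: enum_valP.
(* Each row of [B] has at most one nonzero entry, because distinct classes are disjoint and
   [enum_val] is injective. *)
have cl_eq i k l : i \in cl k -> i \in cl l -> k = l.
  move=> ik il; have [_ tiP _] := and3P eq_classes_partition.
  apply: enum_val_inj; rewrite -/(cl k) -/(cl l).
  by rewrite -(def_pblock tiP (clP k) ik) -(def_pblock tiP (clP l) il).
have -> : \matrix_(i < N, j < N) (sim i j)%:R = B *m B^T.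
  apply/matrixP => i j; rewrite !mxE.
  have Pi : pblock P i \in P.
    by rewrite pblock_mem // (cover_partition eq_classes_partition) inE.
  have iC : i \in pblock P i.
    by rewrite mem_pblock (cover_partition eq_classes_partition) inE.
  have [ki clK] : exists ki, cl ki = pblock P i.
    by exists (enum_rank_in Pi (pblock P i)); apply: enum_rankK_in.
  (* Only the class of [i] contributes to entry [(i, j)], and its term tests whether [j] lies in
     that class. *)
  rewrite (bigD1 ki) //= !mxE clK.
  rewrite iC mul1r (eq_classes_sim _ Pi iC) big1 ?addr0 // => k neqk.
  rewrite !mxE; case: (boolP (i \in _)) => [ik|]; last by rewrite mul0r.
  by case/eqP: neqk; apply: cl_eq ik _; rewrite clK.
have diagE : B^T *m B = diag_mx (\row_k #|cl k|%:R).
  apply/matrixP => k l; rewrite !mxE.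
  (* Entry [(k, l)] counts the points common to [cl k] and [cl l]. *)
  under eq_bigr => i _ do rewrite !mxE -natrM mulnb.
  rewrite -natr_sum -big_mkcond sum1dep_card.
  have [<-|neq_kl] := eqVneq k l.
    by rewrite mulr1n; congr _%:R; apply: eq_card => i; rewrite !inE andbb.
  rewrite mulr0n (_ : #|_| = 0%N) //; apply: eq_card0 => i; rewrite !inE.
  by apply: contra_neqF neq_kl => /andP[]; apply: cl_eq.
(* Sylvester's identity carries ['X^#|P|] on the left and ['X^N] on the right; cancelling leaves
   ['X^(N - #|P|)], the contribution of the padding zeros. *)
have Xn0 : 'X^#|P| != 0 :> {poly R} by rewrite monic_neq0 ?monicXn.
apply: (mulfI Xn0); rewrite char_poly_mulmxC diagE char_poly_trig; last first.
  exact: diag_mx_is_trig.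
rewrite big_cat big_nseq subr0 -Monoid.iteropE big_map big_enum /= mulrCA.
rewrite -exprD subnKC ?card_eq_classes_le // mulrC; congr (_ * _).
rewrite [RHS]big_enum_val; apply: eq_bigr => k _.
by rewrite !mxE eqxx.
Qed.

End EquivalenceSpectrum.

(** Sorting the roots leaves their product of linear factors unchanged. This keeps the claims about
    every ordered list of eigenvalues from being vacuous. *)
Lemma ordered_eigenvalues_exist (R : realType) (N : nat) (A : 'M[R]_N)
    (s : seq R) :
  size s = N -> char_poly A = \prod_(x <- s) ('X - x%:P) ->
  exists lam : 'I_N -> R, ordered_eigenvalues A lam.
Proof.
move=> sz_s charA; pose t := sort >=%R s.
have sz_t : size t = N by rewrite size_sort.
exists (fun i => t`_i); split=> [|i j le_ij].
  rewrite charA -(perm_big _ (permEl (perm_sort >=%R s))) -/t.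
  by rewrite (big_nth 0) sz_t big_mkord.
have sorted_t : sorted >=%R t by apply: sort_sorted => x y; apply: le_total.
by apply: (sorted_leq_nth ge_trans ge_refl _ sorted_t); rewrite ?inE ?sz_t.
Qed.

(** A product of factors ['X - x%:P] over a field determines the multiset of its roots. *)
Lemma ordered_eigenvalues_perm (R : realType) (N : nat) (A : 'M[R]_N)
    (s : seq R) (lam : 'I_N -> R) :
  char_poly A = \prod_(x <- s) ('X - x%:P) -> ordered_eigenvalues A lam ->
  perm_eq (codom lam) s.
Proof.
move=> charA [charA' _]; apply: prod_XsubC_eq.
by rewrite -charA charA' big_image.
Qed.

Lemma gram_mxE (R : realType) (p N : nat) (phi : 'I_N -> 'cV[R]_p)
    (i j : 'I_N) :
  gram_mx phi i j = ((phi i)^T *m phi j) 0 0.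
Proof. by rewrite !mxE; apply: eq_bigr => k _; rewrite !mxE. Qed.

Theorem lemma1 (R : realType) (N p : nat) (hN : (1 <= N)%N) (hp : (N <= p)%N)
    (sim : rel 'I_N) (hsim : equivalence_rel sim)
    (phi : 'I_N -> 'cV[R]_p)
    (hnorm : forall i : 'I_N, euclidean_norm (phi i) = 1)
    (hdot : forall i j : 'I_N,
       ((phi i)^T *m phi j) 0 0 = if sim i j then 1 else 0) :
  (exists lam : 'I_N -> R, ordered_eigenvalues (gram_mx phi) lam) /\
  (forall lam : 'I_N -> R, ordered_eigenvalues (gram_mx phi) lam ->
     [/\ forall i : 'I_N, 0 <= lam i,
         \sum_(i < N) lam i = N%:R,
         #|[set i : 'I_N | lam i != 0]| = #|eq_classes sim|
       & forall i : 'I_N, lam i != 0 ->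
           exists2 C : {set 'I_N}, C \in eq_classes sim & lam i = #|C|%:R]).

Proof.
have gramE : gram_mx phi = \matrix_(i, j) (sim i j)%:R.
  by apply/matrixP => i j; rewrite gram_mxE hdot mxE; case: (sim i j).
have charE : char_poly (gram_mx phi) =
    \prod_(x <- class_spectrum R sim) ('X - x%:P).
  by rewrite gramE; apply: char_poly_equivalence_mx.
split.
  exact: ordered_eigenvalues_exist (size_class_spectrum _ hsim) charE.
move=> lam /(ordered_eigenvalues_perm charE) perm_lam.
have lam_in i : lam i \in class_spectrum R sim.
  by rewrite -(perm_mem perm_lam) codom_f.
(* Sign, sum, number of nonzero entries and membership are all invariant under permutation, so each
   is read off [class_spectrum]. *)
split=> [i||| i]; first exact: (allP (class_spectrum_ge0 R sim)).
- by rewrite -(sum_class_spectrum R hsim) -(perm_big _ perm_lam) big_image.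
- rewrite -(count_class_spectrum R hsim) -(permP perm_lam) count_map cardE.
  rewrite -size_filter /(enum [set _ | _]) -enumT; congr size.
  by apply: eq_filter => i; rewrite !inE.
- exact: class_spectrum_neq0.
Qed.
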